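(* Consider an instance of the Permutation Flowshop Scheduling Problem with $N$ jobs, $M$ machines and integer processing times satisfying $a \le t_{i,j} \le b$ for all $1\le i\le M$, $1\le j\le N$. Then the number of distinct makespan values, i.e. the cardinality of $\{C_{max}(\pi) : \pi \text{ a permutation of the jobs}\}$, is at most $(N+M-1)(b-a)+1$.
   Context: Permutation Flowshop Scheduling Problem (PFSP): an instance consists of $N\ge 1$ jobs, $M\ge 1$ machines, and a matrix of constant non-negative processing times $t_{i,j}$ ($1\le i\le M$, $1\le j\le N$), where $t_{i,j}$ is the processing time of job $j$ on machine $i$. A schedule is a permutation $\pi=(\pi_1,\dots,\pi_N)$ of the jobs. For a given $\pi$ the completion times $C_{i,j}$ are defined by $C_{1,\pi_1}=t_{1,\pi_1}$; $C_{i,\pi_1}=t_{i,\pi_1}+C_{i-1,\pi_1}$ for $1<i\le M$; $C_{1,\pi_j}=t_{1,\pi_j}+C_{1,\pi_{j-1}}$ for $1<j\le N$; and $C_{i,\pi_j}=t_{i,\pi_j}+\max\{C_{i-1,\pi_j},C_{i,\pi_{j-1}}\}$ otherwise. The makespan is $C_{max}(\pi)=C_{M,\pi_N}$. *)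

(* Defs.v *)
From mathcomp Require Import all_boot all_order all_algebra all_fingroup.
From mathcomp Require Import finmap.

Set Implicit Arguments.
Unset Strict Implicit.
Unset Printing Implicit Defensive.

Import Order.TTheory GRing.Theory Num.Theory.
Local Open Scope ring_scope.

Section Flowshop.

(* m.+1 machines and n.+1 jobs, so that both numbers are at least 1; machines, *)
(* jobs and positions in the schedule are numbered from 0.                    *)
Variables (R : realDomainType) (m n : nat).
Variables (t : 'M[R]_(m.+1, n.+1)) (pi : 'S_n.+1).

(* The processing time on machine i of the job in position j of the schedule. *)
(* inord only makes the indices natural numbers: it is used for i <= m and    *)
(* j <= n, where it is the identity on values.                                *)
Definition ptime (i j : nat) : R := t (inord i) (pi (inord j)).

(* [completion i j] is the completion time C_{i, pi_j}: the second index is   *)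
(* the position j in the schedule, not the job itself.                        *)
Fixpoint completion (i : nat) : nat -> R :=
  fix completion_i (j : nat) : R :=
    match i, j with
    | 0, 0 => ptime 0 0
    | i'.+1, 0 => ptime i 0 + completion i' 0
    | 0, j'.+1 => ptime 0 j + completion_i j'
    | i'.+1, j'.+1 =>
        ptime i j + Num.max (completion i' j) (completion_i j')
    end.

Definition makespan : R := completion m n.

End Flowshop.

Definition makespans (R : realDomainType) (m n : nat)
    (t : 'M[R]_(m.+1, n.+1)) : {fset R} :=
  [fset makespan t pi | pi in {: 'S_n.+1}]%fset.

(* Main.v *)
Require Import Defs.
From mathcomp Require Import all_boot all_order all_algebra all_fingroup.
From mathcomp Require Import finmap.

(** The completion time of the job in position [j] on machine [i] is the total
    processing time along a monotone path of operations from [(0, 0)] to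
    [(i, j)], the maximum in the recursion choosing the path.  Every such path
    visits [i + j + 1] cells, so with processing times between [a] and [b]
    all makespans lie between [L * a] and [L * b], where [L = N + M - 1]
    ([completion_bounds]).  Makespans are integers, and an integer interval of
    length [d] contains at most [d + 1] points ([card_int_fset_le]).
    The bounds [a] and [b] need not be integers; this is harmless because the
    counting is done between the smallest and the largest makespan. *)

Set Implicit Arguments.
Unset Strict Implicit.
Unset Printing Implicit Defensive.

Import Order.TTheory GRing.Theory Num.Theory.
Local Open Scope ring_scope.

(** Consecutive elements of a strictly increasing integer sequence differ by at
    least 1. *)
Lemma path_lt_int_last (x : int) (s : seq int) :
  path <%R x s -> x + (size s)%:Z <= last x s.
Proof.
elim: s x => [|y s IHs] x /=; first by rewrite addr0.
case/andP=> lt_xy /IHs; apply: le_trans.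
by rewrite intS addrA lerD2r -ltzD1 ltrD2r.
Qed.

(** Sorting turns the set into a strictly increasing sequence, whose first and
    last elements are then far apart. *)
Lemma card_int_fset_le (R : realDomainType) (S : {fset int}) (d : R) :
    0 <= d -> {in S &, forall x y, (y - x)%:~R <= d} ->
  (#|` S|%fset)%:R <= d + 1.
Proof.
move=> d_ge0 diamS; set s := sort <=%R (enum_fset S).
have sorted_s : sorted <%R s by rewrite sort_lt_sorted fset_uniq.
have mem_s : s =i S by move=> x; rewrite mem_sort.
have -> : #|` S|%fset = size s by rewrite size_sort.
case: s => [|x s] /= in sorted_s mem_s *; first by rewrite addr_ge0.
have le_last := path_lt_int_last sorted_s.
rewrite -natr1 lerD2r; apply: le_trans (diamS x (last x s) _ _).
- by rewrite -[(size s)%:R]/((size s)%:Z%:~R) ler_int lerBrDl.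
- by rewrite -mem_s mem_head.
- by rewrite -mem_s mem_last.
Qed.

(** Both predecessors of a cell [(i, j)] are at the end of paths with [i + j]
    cells, so the bounds do not depend on which one attains the maximum. *)
Lemma completion_bounds (R : realDomainType) (m n : nat)
    (t : 'M[int]_(m.+1, n.+1)) (pi : 'S_n.+1) (a b : R) (i j : nat) :
    (forall i j, a <= (t i j)%:~R <= b) ->
  a *+ (i + j).+1 <= (completion t pi i j)%:~R <= b *+ (i + j).+1.
Proof.
move=> t_ab.
have step i' j' k (c : int) : a *+ k <= c%:~R <= b *+ k ->
    a *+ k.+1 <= (ptime t pi i' j' + c)%:~R <= b *+ k.+1.
  by case/andP=> ac cb; have /andP[at_ tb] := t_ab (inord i') (pi (inord j'));
     rewrite rmorphD !mulrS !lerD.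
elim: i j => [|i IHi]; elim=> [|j IHj].
- exact: t_ab.
- exact: step IHj.
- exact: step (IHi 0%N).
- have {}IHj : a *+ (i + j.+1).+1 <= (completion t pi i.+1 j)%:~R
                  <= b *+ (i + j.+1).+1 by rewrite addnS.
  apply: (step i.+1 j.+1); rewrite maxEle.
  by case: ifP => _; [exact: IHj | exact: IHi].
Qed.

Theorem corollary4 (R : realDomainType) (m n : nat)
    (t : 'M[int]_(m.+1, n.+1)) (a b : R)
    (t_ge0 : forall i j, 0 <= t i j)
    (t_ab : forall i j, a <= (t i j)%:~R <= b) :
  (#|` makespans t|%fset)%:R <= (n.+1 + m.+1 - 1)%N%:R * (b - a) + 1 :> R.
Proof.
have -> : (n.+1 + m.+1 - 1 = (m + n).+1)%N by rewrite addnS subn1 addnC addnS.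
have le_ab : a <= b by have /andP[/le_trans] := t_ab ord0 ord0; apply.
apply: card_int_fset_le; first by rewrite mulr_ge0 ?subr_ge0.
move=> _ _ /imfsetP[/= pi _ ->] /imfsetP[/= pi' _ ->].
have /andP[lo _] := completion_bounds pi m n t_ab.
have /andP[_ hi] := completion_bounds pi' m n t_ab.
by rewrite mulr_natl mulrnBl rmorphB lerB.
Qed.
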